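(* Let $(a,b)$ be an admissible pair, and let $k\in\mathbb{Z}$, $r,s\in\mathbb{N}$ be the unique integers with $$a=\frac{r}{s}\,b^k,\qquad \gcd(r,s)=1,\qquad 1<\frac{r}{s}<b.$$ Then the complexity function $p_{a,b}(n)$ of the leading digit sequence $S_{a,b}$ satisfies $$p_{a,b}(n)=c_{a,b}\,n+d_{a,b},\qquad n=1,2,\dots,$$ where $$c_{a,b}=b-1-\left\lfloor\frac{b-1}{r}\right\rfloor-\left\lfloor\frac{\gcd(b,r)-1}{s}\right\rfloor,$$ $$d_{a,b}=b-1-c_{a,b}=\left\lfloor\frac{b-1}{r}\right\rfloor+\left\lfloor\frac{\gcd(b,r)-1}{s}\right\rfloor.$$
   Context: For an integer $b\ge 3$ and a real $x>0$, the leading digit $D_b(x)\in\{1,2,\dots,b-1\}$ of $x$ in base $b$ is defined by: $D_b(x)=d$ if and only if $d\cdot b^j\le x<(d+1)b^j$ for some $j\in\mathbb{Z}$. For real $a>0$, the leading digit sequence is $S_{a,b}=\{D_b(a^n)\}_{n=1}^\infty$. Its (block) complexity function is $$p_{a,b}(n)=\#\{(D_b(a^m),D_b(a^{m+1}),\dots,D_b(a^{m+n-1})): m=1,2,\dots\},$$ the number of distinct blocks of $n$ consecutive terms occurring in $S_{a,b}$. A pair $(a,b)$ is called admissible if (i) $b$ is a squarefree integer $\ge 5$, and (ii) $a$ is a positive rational number that is not an integral power of $b$ (i.e., $a\ne b^h$ for every $h\in\mathbb{Z}$). *)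

(* Defs.v *)
From HB Require Import structures.
From mathcomp Require Import all_boot all_order all_algebra finmap.
From mathcomp Require Import boolp classical_sets functions cardinality reals.
Set Implicit Arguments.
Unset Strict Implicit.
Unset Printing Implicit Defensive.
Import Order.TTheory GRing.Theory Num.Theory.

Local Open Scope classical_set_scope.
Local Open Scope ring_scope.

Section LeadingDigits.
Variable R : realType.

Definition is_leading_digit (b : nat) (x : R) (d : nat) : Prop :=
  (1 <= d <= b.-1)%N /\
  exists j : int, d%:R * b%:R ^ j <= x < d.+1%:R * b%:R ^ j.

(* Such a digit exists and is unique for x > 0 and b >= 3; the default value 0
   is never a digit. *)
Definition leading_digit (b : nat) (x : R) : nat :=
  xget 0%N [set d | is_leading_digit b x d].

(* The sequence is indexed from 1: its value at n = 0 is never used. *)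
Definition leading_digit_seq (a : R) (b : nat) (n : nat) : nat :=
  leading_digit b (a ^+ n).

Definition block (u : nat -> nat) (m n : nat) : n.-tuple nat :=
  [tuple u (m + i)%N | i < n].

(* fset_set sends an infinite set to the empty one, but there are at most
   b ^ n blocks of length n. *)
Definition complexity (a : R) (b n : nat) : nat :=
  #|` fset_set [set w : n.-tuple nat | exists m : nat,
        (1 <= m)%N /\ w = block (leading_digit_seq a b) m n] |.

Definition squarefree (b : nat) : Prop :=
  forall d : nat, (d ^ 2 %| b)%N -> d = 1%N.

Definition admissible (a : R) (b : nat) : Prop :=
  [/\ squarefree b, (5 <= b)%N, 0 < a, rational a
    & forall h : int, a <> b%:R ^ h].

End LeadingDigits.

(* %/ on nat is the floor of the quotient; the outer subtractions are taken in
   int, so they do not truncate. *)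
Definition slope (b r s : nat) : int :=
  (b%:Z - 1 - ((b - 1) %/ r)%N%:Z - ((gcdn b r - 1) %/ s)%N%:Z)%R.

Definition intercept (b r s : nat) : int := (b%:Z - 1 - slope b r s)%R.

(* Main.v *)
Require Import Defs.
From mathcomp Require Import all_boot all_order all_algebra finmap zify ring lra.
From mathcomp Require Import classical_sets cardinality reals exp.
Import Order.TTheory GRing.Theory Num.Theory.
Local Open Scope ring_scope.

(** Write lam = r/s. Leading digits do not see powers of b, so the sequence
records the position of the orbit lam, lam^2, ... on the circle of positive
reals modulo powers of b, cut into arcs at the points 1, ..., b-1. The code of
length n of x lists the digits of x, lam x, ..., lam^(n-1) x; the blocks to be
counted are the codes of the points lam^m with m >= 1.

The code can only change, as x moves to the right, at the breakpoints
d lam^(-i), with 0 <= i < n and 1 <= d <= b-1, and the blocks are in bijection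
with the distinct breakpoints of the circle:
- every code is the code of a breakpoint, the closest one to the left
  ([code_breakpoint]);
- every breakpoint has the same code as all points slightly to its right
  ([code_right_constant]), and the orbit meets every arc ([powers_dense])
  because no positive power of lam is a power of b ([ratio_powers_neq]);
- distinct breakpoints have distinct codes ([code_inj]): the arc of one digit
  spans a ratio of at most 2, and b >= 4 leaves no room for two points of that
  arc to be moved by lam^i into the same digit at different scales.

What remains is arithmetic: which breakpoints coincide on the circle? A
breakpoint d lam^(-i) with i > 0 coincides with some d' lam^(-i') with i' < i
exactly when d s^j b^h = d' r^j for a suitable d', with j = i - i'. For b
squarefree, divisibility shows that this depends on d alone, and already
happens with j = 1 ([absorbed_collision], [collision_absorbed]): either r
divides d (h = 0), or d = t r/g with s t < g, where g = gcd(b, r) (h = 1).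
These two disjoint families have (b-1)/r and (g-1)/s members, rounded down
([count_absorbed]), and their sum is the intercept. The level i = 0 contributes
b-1 breakpoints, and each later level contributes those d that are not of this
form; hence the affine formula. *)

(** * Arithmetic of coinciding breakpoints *)

Lemma squarefree_coprime (b c e : nat) :
  squarefree b -> b = (c * e)%N -> coprime c e.
Proof.
move=> sqf bE; apply/eqP; apply: sqf.
by rewrite bE expnS expn1 dvdn_mul ?dvdn_gcdl ?dvdn_gcdr.
Qed.

(** The form in which squarefreeness of b enters the arithmetic: a prime shared by
    b and r is used up by the gcd. *)
Lemma squarefree_coprime_cofactor (b r : nat) : squarefree b -> (0 < b)%N ->
  coprime r (b %/ gcdn b r).
Proof.
move=> sqf b0; set g := gcdn b r.
have g0 : (0 < g)%N by rewrite gcdn_gt0 b0.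
have bE : (b = g * (b %/ g))%N by rewrite mulnC divnK ?dvdn_gcdl.
have rE : (r = g * (r %/ g))%N by rewrite mulnC divnK ?dvdn_gcdr.
have crb : coprime (r %/ g) (b %/ g).
  by rewrite /coprime -(eqn_pmul2l g0) muln_gcdr -rE -bE muln1 gcdnC.
by rewrite {1}rE coprimeMl crb andbT; apply: squarefree_coprime sqf bE.
Qed.

(** The digits d whose breakpoint d lam^(-i), for i > 0, already occurs at the
    level i - 1. The two alternatives are d = t r and d = t r / gcd(b, r); in the
    second one the bound on t keeps the earlier digit t s b / gcd(b, r) below b. *)
Definition absorbed (b r s d : nat) : bool :=
  let g := gcdn b r in
  (r %| d)%N || (r %/ g %| d)%N && (s * (d %/ (r %/ g)) < g)%N.

(** A coincidence across j levels already forces one across a single level. With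
    g = gcd(b, r), b = g b1 and r = g r1, size considerations give h <= j. If
    h < j, a factor g survives cancellation and r1^j g^(j - h), a multiple of r,
    divides d. If h = j, all factors g cancel and r1^j divides d; the bound
    d' < b then yields the bound on the quotient, as r1 < s b1. *)
Lemma absorbed_collision (b r s d d' j h : nat) :
  squarefree b -> (0 < s)%N -> coprime r s -> (r < s * b)%N ->
  (0 < j)%N -> (0 < d < b)%N -> (0 < d' < b)%N ->
  (d * s ^ j * b ^ h = d' * r ^ j)%N -> absorbed b r s d.
Proof.
move=> sqf s0 crs rsb j0 /andP[d0 db] /andP[d'0 d'b] E.
have r0 : (0 < r)%N.
  rewrite lt0n; apply/eqP => r0; move: E; rewrite r0 exp0n // muln0 => /eqP.
  by rewrite !muln_eq0 !expn_eq0; lia.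
rewrite /absorbed /=; set g := gcdn b r; set r1 := (r %/ g)%N.
have g0 : (0 < g)%N by rewrite gcdn_gt0 r0 orbT.
have bE : (b = g * (b %/ g))%N by rewrite mulnC divnK ?dvdn_gcdl.
have rE : (r = g * r1)%N by rewrite mulnC divnK ?dvdn_gcdr.
set b1 := (b %/ g)%N in bE.
have /andP[cgb crb] : coprime g b1 && coprime r1 b1.
  by rewrite -coprimeMl -rE squarefree_coprime_cofactor //; lia.
have cr1s : coprime r1 s.
  by move: crs; rewrite rE coprimeMl => /andP[].
have hj : (h <= j)%N.
  rewrite leqNgt; apply/negP => hj.
  have L : (r ^ j * d' < (s * b) ^ j * b)%N.
    apply: (@leq_trans ((s * b) ^ j * d').+1); last first.
      by rewrite ltn_pmul2l // expn_gt0; lia.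
    by rewrite ltnS leq_mul2r leq_exp2r // ltnW ?orbT.
  have U : ((s * b) ^ j * b <= d * s ^ j * b ^ h)%N.
    rewrite -(subnK hj) expnD expnMn expnS.
    rewrite [leqLHS](_ : _ = (1 * s ^ j) * (1 * (b * b ^ j)))%N; last by ring.
    by rewrite leq_mul // leq_mul // expn_gt0; lia.
  by move: L; rewrite ltnNge [(_ * d')%N]mulnC -E U.
case: (eqVneq h j) E => [->|hj'] E.
  apply/orP; right.
  have E1 : (d * (s * b1) ^ j = d' * r1 ^ j)%N.
    apply/eqP; rewrite -(eqn_pmul2l (_ : 0 < g ^ j)%N) ?expn_gt0 ?g0 //.
    apply/eqP; move: E; rewrite bE rE !expnMn => E.
    by transitivity (d * s ^ j * (g ^ j * b1 ^ j))%N; [|rewrite E]; ring.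
  have c1 : coprime (r1 ^ j) ((s * b1) ^ j).
    by rewrite coprime_pexpl // coprime_pexpr // coprimeMr cr1s crb.
  have /dvdnP[t dE] : (r1 ^ j %| d)%N.
    by rewrite -(Gauss_dvdl d c1) E1 dvdn_mull.
  have d'E : (d' = t * (s * b1) ^ j)%N.
    apply/eqP; rewrite -(eqn_pmul2r (_ : 0 < r1 ^ j)%N); last first.
      by rewrite expn_gt0; lia.
    by rewrite -E1 dE; apply/eqP; ring.
  have r10 : (0 < r1)%N by lia.
  have r1sb : (r1 <= s * b1)%N.
    rewrite -(leq_pmul2l g0) -rE mulnCA -bE; exact: ltnW.
  move: (j0) dE d'E; case: (j) => // i _ dE d'E.
  rewrite dE expnS mulnCA dvdn_mulr //= mulKn //.
  rewrite -(ltn_pmul2r (_ : 0 < b1)%N); last by lia.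
  rewrite -bE; apply: leq_ltn_trans d'b; rewrite d'E expnS.
  rewrite [leqLHS](_ : _ = t * (s * b1 * r1 ^ i))%N; last by ring.
  rewrite leq_mul // leq_mul //.
  by case: (i) => [|k]; [rewrite !expn0 | rewrite leq_exp2r].
apply/orP; left.
have lhj : (h < j)%N by rewrite ltn_neqAle hj' hj.
have E2 : (d * s ^ j * b1 ^ h = d' * (r1 ^ j * g ^ (j - h)))%N.
  apply/eqP; rewrite -(eqn_pmul2l (_ : 0 < g ^ h)%N) ?expn_gt0 ?g0 //.
  have bhE : (b ^ h = g ^ h * b1 ^ h)%N by rewrite {1}bE expnMn.
  have rjE : (r ^ j = g ^ h * (r1 ^ j * g ^ (j - h)))%N.
    by rewrite {1}rE expnMn -{1}(subnKC hj) expnD -mulnA [(g ^ (j - h) * _)%N]mulnC.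
  by rewrite [X in _ == X]mulnCA -rjE -E bhE; apply/eqP; ring.
have c2 : coprime (r1 ^ j * g ^ (j - h)) (s ^ j * b1 ^ h).
  have cgs : coprime g s by move: crs; rewrite rE coprimeMl => /andP[].
  by rewrite coprimeMl !coprimeMr !coprimeXl ?coprimeXr.
apply: (@dvdn_trans (r1 ^ j * g ^ (j - h))%N).
  rewrite {1}rE [(g * _)%N]mulnC; apply: dvdn_mul; apply: dvdn_exp => //.
  by rewrite subn_gt0.
by rewrite -(Gauss_dvdl d c2) mulnA E2 dvdn_mull.
Qed.

Lemma collision_absorbed (b r s d : nat) : (s < r)%N -> (0 < s)%N ->
  (0 < d < b)%N -> absorbed b r s d ->
  exists d' h : nat, (0 < d' < b)%N /\ (d * s * b ^ h = d' * r)%N.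
Proof.
move=> sr s0 /andP[d0 db] /orP[/dvdnP[t dE]|/andP[/dvdnP[t dE]]].
  exists (t * s)%N, 0%N; split; last by rewrite dE; ring.
  apply/andP; split; first by nia.
  by apply: leq_ltn_trans db; rewrite dE leq_mul // ltnW.
set g := gcdn b r; set r1 := (r %/ g)%N in dE *.
have g0 : (0 < g)%N by rewrite gcdn_gt0; lia.
have bE : (b = g * (b %/ g))%N by rewrite mulnC divnK ?dvdn_gcdl.
have rE : (r = g * r1)%N by rewrite mulnC divnK ?dvdn_gcdr.
rewrite dE mulnK; last by lia.
move=> stg; exists (t * s * (b %/ g))%N, 1%N; split; last first.
  by rewrite {1}bE {1}rE; ring.
have ? : (0 < b %/ g)%N by lia.
have ? : (0 < t)%N by lia.
apply/andP; split; first by rewrite !muln_gt0; lia.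
by rewrite [X in (_ < X)%N]bE ltn_pmul2r // mulnC.
Qed.

(** The two alternatives exclude each other: r divides d means that d / (r / g) is
    a multiple of g, while the second alternative keeps it below g. *)
Lemma count_absorbed (b r s : nat) : (0 < b)%N -> (0 < r)%N -> (0 < s)%N ->
  (r < s * b)%N ->
  count (absorbed b r s) (iota 1 (b - 1)) =
  ((b - 1) %/ r + (gcdn b r - 1) %/ s)%N.
Proof.
move=> b0 r0 s0 rsb.
set g := gcdn b r; set r1 := (r %/ g)%N.
have g0 : (0 < g)%N by rewrite gcdn_gt0 r0 orbT.
have rE : (r = g * r1)%N by rewrite mulnC divnK ?dvdn_gcdr.
have gb : (g <= b)%N by rewrite dvdn_leq ?dvdn_gcdl.
have r10 : (0 < r1)%N by lia.
pose P d := (r %| d)%N; pose Q d := (r1 %| d)%N && (s * (d %/ r1) < g)%N.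
have disj : count (predI P Q) (iota 1 (b - 1)) = 0%N.
  apply/eqP; rewrite -leqn0 leqNgt -has_count; apply/hasPn => d.
  rewrite mem_iota => /andP[d0 _]; apply/negP => /= /and3P[/dvdnP[t dE] _].
  have t0 : (0 < t)%N by lia.
  rewrite dE {1}rE mulnA mulnK // ltnNge mulnA -{1}[g]mul1n => /negP; apply.
  by rewrite leq_mul // muln_gt0 s0.
rewrite [LHS](_ : _ = count (predU P Q) (iota 1 (b - 1))) //.
have := count_predUI P Q (iota 1 (b - 1)); rewrite disj addn0 => ->.
congr addn.
  rewrite divn_count_dvd -sum1_count big_mkcond /index_iota subSS subn0.
  by apply: eq_bigr => i _; rewrite /P; case: ifP.
rewrite -size_filter -[RHS](size_iota 1) -[RHS](size_map (muln r1)).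
apply/perm_size/uniq_perm.
- by rewrite filter_uniq // iota_uniq.
- by rewrite map_inj_uniq ?iota_uniq // => x y /eqP; rewrite eqn_pmul2l // => /eqP.
move=> d; rewrite mem_filter mem_iota; apply/idP/mapP => [|[t]].
  move=> /andP[/andP[/dvdnP[t ->]]]; rewrite mulnK // => stg tb.
  exists t; last by rewrite mulnC.
  rewrite mem_iota; apply/andP; split; first by lia.
  by rewrite add1n ltnS leq_divRL //; lia.
rewrite mem_iota add1n ltnS leq_divRL // => /andP[t0 tg] ->.
rewrite /Q mulKn // dvdn_mulr //=.
have bE : (b = g * (b %/ g))%N by rewrite mulnC divnK ?dvdn_gcdl.
have r1b : (r1 < s * (b %/ g))%N.
  by rewrite -(ltn_pmul2l g0) -rE mulnCA -bE.
nia.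
Qed.

(** * Density of the orbit modulo powers of the base *)

(** Two of the points 0, t, 2t, ..., Nt modulo 1 share one of N boxes, so some
    multiple of t lies within 1/N of an integer, at a nonzero signed distance e;
    the multiples of e then step into every interval longer than |e|. *)
Lemma irrational_rotation_dense (R : realType) (t : R) :
  (forall (m : nat) (h : int), (0 < m)%N -> t *+ m != h%:~R) ->
  forall x y : R, x < y ->
  exists (m : nat) (h : int), (0 < m)%N /\ x < t *+ m + h%:~R < y.
Proof.
move=> irr x y xy.
have [q [h0 [q0 small]]] : exists (q : nat) (h : int),
    (0 < q)%N /\ `|t *+ q + h%:~R| < y - x.
  pose N := (Num.truncn (y - x)^-1).+1.
  have Nxy : 1 < N%:R * (y - x).
    by rewrite -ltr_pdivrMr ?subr_gt0 // div1r truncnS_gt.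
  pose fr m := t *+ m - (Num.floor (t *+ m))%:~R.
  have fr_itv m : 0 <= fr m < 1.
    have := floor_itv (t *+ m); rewrite intrD /fr; lra.
  pose f (m : 'I_N.+1) : 'I_N := inord (Num.truncn (N%:R * fr m)).
  have fE m : f m = Num.truncn (N%:R * fr m) :> nat.
    rewrite inordK // truncn_lt_nat; have /andP[f0 f1] := fr_itv m.
      by rewrite gtr_pMr ?ltr0n.
    by rewrite mulr_ge0.
  have [m1 [m2 [m12 fm]]] : exists m1 m2 : 'I_N.+1, (m1 < m2)%N /\ f m1 = f m2.
    have /injectivePn[u [v uv fuv]] : ~~ injectiveb f.
      by apply/negP => /injectiveP/leq_card; rewrite !card_ord ltnn.
    case: (ltngtP u v) => [uv'|uv'|/val_inj uv'].
    - by exists u, v.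
    - by exists v, u.
    - by rewrite uv' eqxx in uv.
  exists (m2 - m1)%N, (Num.floor (t *+ m1) - Num.floor (t *+ m2)).
  split; first by rewrite subn_gt0.
  rewrite [X in `|X|](_ : _ = fr m2 - fr m1); last first.
    by rewrite /fr mulrnBr ?(ltnW m12) // intrB; ring.
  rewrite -(ltr_pM2l (_ : 0 < N%:R)) ?ltr0n //; apply: lt_trans Nxy.
  rewrite -[N%:R]gtr0_norm ?ltr0n // -normrM mulrBr.
  have tr m : (f m)%:R <= N%:R * fr m < (f m).+1%:R.
    by rewrite fE truncn_itv // mulr_ge0 //; have /andP[] := fr_itv m.
  have := tr m1; have := tr m2; rewrite fm -natr1 => T2 T1.
  rewrite ltr_norml; lra.
set e := t *+ q + h0%:~R in small.
have e0 : e != 0.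
  apply: contra (irr q (- h0) q0) => /eqP ee; apply/eqP.
  by rewrite intrN; move: ee; rewrite /e; lra.
have mulE k (h1 : int) :
    t *+ (q * k) + (h0 * k%:Z + h1)%:~R = k%:R * e + h1%:~R.
  by rewrite intrD intrM /e mulrnA mulrDr mulr_natl addrA [k%:R * _]mulrC.
(* An integer translation brings the interval to the side of 0 to which the
   multiples of e run: to the right if e > 0, to the left if e < 0. *)
have [e_gt0|e_lt0|/eqP] := ltrgt0P e; last by rewrite (negbTE e0).
- rewrite gtr0_norm // in small.
  have /andP[Fx _] := floor_itv x; set h1 := Num.floor x in Fx.
  have x'0 : 0 <= (x - h1%:~R) / e by rewrite divr_ge0 ?subr_ge0 // ltW.
  have := truncn_itv x'0; set k := Num.truncn _ => /andP[].
  rewrite ler_pdivlMr // ltr_pdivrMr // => k1 k2.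
  exists (q * k.+1)%N, (h0 * k.+1%:Z + h1); split; first by rewrite muln_gt0 q0.
  rewrite mulE; move: k2; rewrite -natr1 mulrDl; lra.
- rewrite ltr0_norm // in small.
  have /andP[Fy _] := floor_itv (- y); set h1 := Num.floor (- y) in Fy.
  have y'0 : 0 <= (y + h1%:~R) / e.
    by rewrite -mulrNN mulr_ge0 // oppr_ge0 ?invr_le0; lra.
  have := truncn_itv y'0; set k := Num.truncn _ => /andP[].
  rewrite ler_ndivlMr // ltr_ndivrMr // => k1 k2.
  exists (q * k.+1)%N, (h0 * k.+1%:Z - h1); split; first by rewrite muln_gt0 q0.
  rewrite mulE intrN; move: k2; rewrite -natr1 mulrDl; lra.
Qed.

Lemma ln_exprz (R : realType) (x : R) (j : int) : 0 < x -> ln (x ^ j) = j%:~R * ln x.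
Proof.
move=> x0; case: j => n; first by rewrite -exprnP lnXn // -[LHS]mulr_natl.
by rewrite NegzE -exprnN lnV ?posrE ?exprn_gt0 // lnXn // intrN mulNr -mulr_natl.
Qed.

Lemma powers_dense (R : realType) (B lam : R) : 1 < B -> 0 < lam ->
  (forall (m : nat) (h : int), (0 < m)%N -> lam ^+ m != B ^ h) ->
  forall x y : R, 0 < x -> x < y ->
  exists (m : nat) (h : int), (0 < m)%N /\ x < lam ^+ m * B ^ h < y.
Proof.
move=> B1 lam0 indep x y x0 xy; have y0 := lt_trans x0 xy.
have B0 : 0 < B by lra.
have lnB : 0 < ln B by rewrite ln_gt0.
have P j : 0 < B ^ j by rewrite exprz_gt0.
have [||m [h [m0 mh]]] := @irrational_rotation_dense R (ln lam / ln B) _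
  (ln x / ln B) (ln y / ln B).
- move=> m h m0; apply: contra (indep m h m0) => /eqP E; apply/eqP.
  apply: ln_inj; rewrite ?posrE ?exprn_gt0 // lnXn // ln_exprz // -E.
  by rewrite mulrnAl divfK // gt_eqF.
- by rewrite ltr_pM2r ?invr_gt0 // ltr_ln ?posrE.
exists m, h; split=> //; move: mh.
rewrite ltr_pdivrMr // ltr_pdivlMr // mulrDl mulrnAl divfK ?gt_eqF //.
rewrite -lnXn // -ln_exprz // -lnM ?posrE ?exprn_gt0 //.
by rewrite !ltr_ln ?posrE ?mulr_gt0 ?exprn_gt0.
Qed.

Lemma exprz_bracket (R : realType) (B x : R) : 1 < B -> 0 < x ->
  exists j : int, B ^ j <= x < B ^ (j + 1).
Proof.
move=> B1 x0; have B0 : 0 < B by lra.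
have lnB : 0 < ln B by rewrite ln_gt0.
have P j : 0 < B ^ j by rewrite exprz_gt0.
exists (Num.floor (ln x / ln B)).
rewrite -ler_ln ?posrE // -ltr_ln ?posrE // !ln_exprz //.
by rewrite -ler_pdivlMr // -ltr_pdivrMr // floor_itv.
Qed.

(** * Leading digits and codes of points *)

Section LeadingDigit.
Local Set Implicit Arguments.
Local Unset Strict Implicit.
Variables (R : realType) (b : nat).
Hypothesis b_gt1 : (1 < b)%N.
Local Notation B := (b%:R : R).

Let B_gt1 : 1 < B. Proof. by rewrite ltr1n. Qed.
Let B_gt0 : 0 < B. Proof. exact: lt_trans ltr01 B_gt1. Qed.
Let Bz_gt0 (j : int) : 0 < B ^ j. Proof. exact: exprz_gt0. Qed.

Lemma natr_exprzS (j : int) : B ^ (j + 1) = B * B ^ j.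
Proof. by rewrite expfzDr ?gt_eqF // expr1z mulrC. Qed.

Lemma leading_digit_eq (x : R) (d : nat) (j : int) : (0 < d < b)%N ->
  d%:R * B ^ j <= x < d.+1%:R * B ^ j -> leading_digit b x = d.
Proof.
have exp_le (d1 d2 : nat) (j1 j2 : int) : (d1 < b)%N -> (0 < d2)%N ->
    x < d1.+1%:R * B ^ j1 -> d2%:R * B ^ j2 <= x -> j2 <= j1.
  move=> d1b d20 U L; rewrite leNgt; apply/negP => j12.
  have : B ^ (j1 + 1) <= B ^ j2 by rewrite ler_eXz2l // lezD1.
  have : d1.+1%:R * B ^ j1 <= B * B ^ j1 by rewrite ler_pM2r // ler_nat.
  have : 1 * B ^ j2 <= d2%:R * B ^ j2 by rewrite ler_pM2r // ler1n.
  rewrite natr_exprzS; lra.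
move=> dI /andP[L U].
apply: xget_unique => [|d' [d'I [j' /andP[L' U']]]].
  by split; [lia | exists j; rewrite L U].
have jj : j = j' by apply/eqP; rewrite eq_le; apply/andP; split;
  [apply: exp_le U' L | apply: exp_le U L']; lia.
rewrite -jj in L' U'.
have : d'%:R < d.+1%:R :> R by rewrite -(ltr_pM2r (Bz_gt0 j)) (le_lt_trans L').
have : d%:R < d'.+1%:R :> R by rewrite -(ltr_pM2r (Bz_gt0 j)) (le_lt_trans L).
rewrite !ltr_nat; lia.
Qed.

Lemma leading_digitP (x : R) : 0 < x ->
  (0 < leading_digit b x < b)%N /\
  exists j : int, (leading_digit b x)%:R * B ^ j <= x
                  < (leading_digit b x).+1%:R * B ^ j.
Proof.
move=> x0; have [j /andP[jx xj]] := exprz_bracket _ _ _ B_gt1 x0.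
have /truncn_itv : 0 <= x / B ^ j by rewrite divr_ge0 // ltW.
set d := Num.truncn _; rewrite ler_pdivlMr // ltr_pdivrMr // => dI.
have d0 : (0 < d < b)%N.
  rewrite truncn_gt0 ler_pdivlMr // mul1r jx /=.
  rewrite truncn_lt_nat; last by rewrite divr_ge0 // ltW.
  by rewrite ltr_pdivrMr // -natr_exprzS.
by rewrite (leading_digit_eq d0 dI); split=> //; exists j.
Qed.

Lemma leading_digit_scale (x : R) (h : int) : 0 < x ->
  leading_digit b (x * B ^ h) = leading_digit b x.
Proof.
move=> x0; have [dI [j /andP[L U]]] := leading_digitP x0.
apply: (@leading_digit_eq _ _ (j + h)) => //.
by rewrite expfzDr ?gt_eqF // !mulrA ler_pM2r // ltr_pM2r // L U.
Qed.

End LeadingDigit.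

Section Codes.
Local Set Implicit Arguments.
Local Unset Strict Implicit.
Variables (R : realType) (b : nat) (lam : R).
Hypotheses (b_gt1 : (1 < b)%N) (lam_gt0 : 0 < lam).
Local Notation B := (b%:R : R).

Let B_gt1 : 1 < B. Proof. by rewrite ltr1n. Qed.
Let B_gt0 : 0 < B. Proof. exact: lt_trans ltr01 B_gt1. Qed.
Let Bz_gt0 (j : int) : 0 < B ^ j. Proof. exact: exprz_gt0. Qed.
Let lamX_gt0 (i : nat) : 0 < lam ^+ i. Proof. exact: exprn_gt0. Qed.

Definition code (n : nat) (x : R) : n.-tuple nat :=
  [tuple leading_digit b (lam ^+ i * x) | i < n].

Lemma eq_code (n : nat) (x y : R) :
  (forall i, (i < n)%N ->
     leading_digit b (lam ^+ i * x) = leading_digit b (lam ^+ i * y)) <->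
  code n x = code n y.
Proof.
split=> [E|E i ltin]; first by apply: eq_from_tnth => i; rewrite !tnth_mktuple E.
by have := congr1 (fun w => tnth w (Ordinal ltin)) E; rewrite !tnth_mktuple.
Qed.

Lemma code_scale (n : nat) (x : R) (h : int) : 0 < x ->
  code n (x * B ^ h) = code n x.
Proof.
by move=> x0; apply/eq_code => i _; rewrite mulrA leading_digit_scale ?mulr_gt0.
Qed.

(** Each digit holds on an interval closed on the left, so finitely many of them
    hold simultaneously a little to the right of x. *)
Lemma code_right_constant (n : nat) (x : R) : 0 < x ->
  exists2 y, x < y & forall z, x <= z < y -> code n z = code n x.
Proof.
move=> x0; suff [y xy Ey] : exists2 y, x < y & forall z, x <= z < y ->
    forall i, (i < n)%N ->
    leading_digit b (lam ^+ i * z) = leading_digit b (lam ^+ i * x).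
  by exists y => // z xzy; apply/eq_code/Ey.
elim: n => [|n [y xy Ey]]; first by exists (x + 1); [lra | ].
have [dI [j /andP[L U]]] := leading_digitP b_gt1 (mulr_gt0 (lamX_gt0 n) x0).
set d := leading_digit _ _ in dI L U.
exists (Num.min y (d.+1%:R * B ^ j / lam ^+ n)).
  by rewrite lt_min xy ltr_pdivlMr // mulrC.
move=> z; rewrite lt_min => /and3P[xz zy zU] i.
rewrite ltnS leq_eqVlt => /predU1P[->|]; last by apply: Ey; rewrite xz.
apply: (leading_digit_eq b_gt1 dI (j := j)); move: zU; rewrite ltr_pdivlMr // mulrC => ->.
by rewrite (le_trans L) // ler_pM2l.
Qed.

(** Each digit of the code of x has held since a breakpoint at most x; the largest
    of these n breakpoints has the same code as x. *)
Lemma code_breakpoint (n : nat) (x : R) : (0 < n)%N -> 0 < x ->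
  exists i d : nat,
    [/\ (i < n)%N, (0 < d < b)%N & code n (d%:R / lam ^+ i) = code n x].
Proof.
move=> n0 x0.
suff [i [d [j [ltin dI px Ep]]]] : exists (i d : nat) (j : int),
    let p := d%:R * B ^ j / lam ^+ i in
    [/\ (i < n)%N, (0 < d < b)%N, p <= x & forall z, p <= z <= x ->
    forall i, (i < n)%N ->
    leading_digit b (lam ^+ i * z) = leading_digit b (lam ^+ i * x)].
  exists i, d; split=> //; rewrite -(code_scale _ j).
    by rewrite mulrAC; apply/eq_code/Ep; rewrite lexx.
  by rewrite divr_gt0 // ltr0n; case/andP: dI.
elim: n n0 => // n IH _.
have [dI [j /andP[L U]]] := leading_digitP b_gt1 (mulr_gt0 (lamX_gt0 n) x0).
set d := leading_digit _ _ in dI L U.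
have En z : d%:R * B ^ j / lam ^+ n <= z -> z <= x ->
    leading_digit b (lam ^+ n * z) = d.
  rewrite ler_pdivrMr // => Lz zx; apply: (leading_digit_eq b_gt1 dI (j := j)).
  by rewrite [lam ^+ n * z]mulrC Lz (le_lt_trans _ U) // mulrC ler_pM2l.
have Ln : d%:R * B ^ j / lam ^+ n <= x by rewrite ler_pdivrMr // [x * _]mulrC.
case: (posnP n) => [n0|/IH[i [d' [j' [ltin dI' px Ep]]]]].
  exists n, d, j; split=> // z /andP[pz zx] i.
  by rewrite {1}n0 ltnS leqn0 => /eqP i0; rewrite i0 -n0 En.
have [pp|pp] := leP (d%:R * B ^ j / lam ^+ n) (d'%:R * B ^ j' / lam ^+ i).
  exists i, d', j'; split=> // [|z /andP[pz zx] i']; first exact: ltnW.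
  rewrite ltnS leq_eqVlt => /predU1P[->|]; last by apply: Ep; rewrite pz.
  by apply: En => //; apply: le_trans pz.
exists n, d, j; split=> // z /andP[pz zx] i'.
rewrite ltnS leq_eqVlt => /predU1P[->|]; first exact: En.
by apply: Ep; rewrite zx (le_trans (ltW pp)).
Qed.

(** The points of the circle at which some digit of the code starts, without a
    choice of representative modulo powers of b. *)
Definition breakpoint (n : nat) (q : R) : Prop :=
  exists (i d : nat) (j : int),
    [/\ (i < n)%N, (0 < d < b)%N & lam ^+ i * q = d%:R * B ^ j].

(** At a breakpoint q, some lam^i q equals d b^j, the left end of the arc of the
    digit d. If lam^i p had the same digit, it would lie in an arc of that digit at
    a lower scale, hence below (d + 1) b^(j - 1), which for b >= 4 is at most half
    of d b^j; but q < 2 p. *)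
Lemma code_jump (n : nat) (p q : R) : (3 < b)%N -> breakpoint n q ->
  0 < p -> p < q -> q < 2 * p -> code n p <> code n q.
Proof.
move=> b4 [i [d [j [ltin dI qE]]]] p0 pq q2p /eq_code/(_ i ltin).
rewrite (@leading_digit_eq R b b_gt1 (lam ^+ i * q) d j) //; last first.
  by rewrite qE lexx ltr_pM2r // ltr_nat ltnSn.
have [_ [j1 /andP[L U]]] := leading_digitP b_gt1 (mulr_gt0 (lamX_gt0 i) p0).
move=> dE; rewrite dE in L U.
have d1 : 1 <= d%:R :> R by rewrite ler1n; case/andP: dI.
have uv : lam ^+ i * p < d%:R * B ^ j by rewrite -qE ltr_pM2l.
have vu : d%:R * B ^ j < 2 * (lam ^+ i * p) by rewrite -qE mulrCA ltr_pM2l.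
have jj : j1 < j.
  rewrite -(ltr_eXz2l B_gt1) -(ltr_pM2l (_ : 0 < d%:R)); last by lra.
  exact: le_lt_trans uv.
have Bj : B ^ (j1 + 1) <= B ^ j by rewrite ler_eXz2l // lezD1.
have B4 : 4 * B ^ j1 <= B ^ j.
  by apply: le_trans Bj; rewrite natr_exprzS // ler_pM2r // ler_nat.
have : d%:R * (4 * B ^ j1) <= d%:R * B ^ j by rewrite ler_pM2l //; lra.
have : 1 * B ^ j1 <= d%:R * B ^ j1 by rewrite ler_pM2r.
move: U; rewrite -natr1 mulrDl; lra.
Qed.

(** Equality of the first digits puts p and a multiple of q by a power of b in a
    single arc [d b^j, (d + 1) b^j), hence within a factor 2 of each other, and
    [code_jump] excludes either order between them. *)
Lemma code_inj (n : nat) (p q : R) : (3 < b)%N -> (0 < n)%N ->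
  0 < p -> 0 < q ->
  breakpoint n p -> breakpoint n q -> code n p = code n q ->
  exists h : int, p = q * B ^ h.
Proof.
move=> b4 n0 p0 q0 bp bq E.
have := (eq_code n p q).2 E 0%N n0; rewrite !mul1r => E0.
have [dI [j /andP[L U]]] := leading_digitP b_gt1 p0.
have [_ [j' /andP[L' U']]] := leading_digitP b_gt1 q0.
rewrite -E0 in L' U'; set d := leading_digit b p in dI L U L' U'.
exists (j - j'); set q1 := q * _.
have BjE : B ^ j = B ^ j' * B ^ (j - j') by rewrite -expfzDr ?gt_eqF // addrC subrK.
have L1 : d%:R * B ^ j <= q1 by rewrite BjE mulrA ler_pM2r.
have U1 : q1 < d.+1%:R * B ^ j by rewrite BjE mulrA ltr_pM2r.
have d2 : d.+1%:R * B ^ j <= 2 * (d%:R * B ^ j).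
  rewrite mulrA ler_pM2r // -natrM ler_nat mul2n -addnn -addn1 leq_add2l.
  by case/andP: dI.
have q10 : 0 < q1 by rewrite mulr_gt0.
have E1 : code n q1 = code n p by rewrite code_scale.
have bq1 : breakpoint n q1.
  have [i [e [l [ltin eI qE]]]] := bq; exists i, e, (l + (j - j')); split=> //.
  by rewrite mulrA qE [X in _ = _ * X]expfzDr ?gt_eqF // mulrA.
case: (ltgtP p q1) => // pq.
  by case: (@code_jump n p q1); rewrite ?E1 //; lra.
by case: (@code_jump n q1 p); rewrite ?E1 //; lra.
Qed.

End Codes.

(** * Coincidences between breakpoints *)

(** The multiplicative form of the irrationality of log_b (r/s). *)
Lemma ratio_powers_neq (R : realType) (b r s : nat) :
  squarefree b -> (1 < b)%N -> coprime r s -> (0 < s)%N -> (s < r)%N ->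
  (r < s * b)%N -> forall (m : nat) (h : int), (0 < m)%N ->
  (r%:R / s%:R) ^+ m != b%:R ^ h :> R.
Proof.
move=> sqf b1 crs s0 sr rsb m h m0; apply/negP => /eqP E.
have r0 : (0 < r)%N by lia.
have lam1 : 1 < r%:R / s%:R :> R by rewrite ltr_pdivlMr ?ltr0n // mul1r ltr_nat.
have h0 : 0 < h.
  rewrite -(ltr_eXz2l (_ : 1 < b%:R :> R)) ?ltr1n // expr0z -E.
  by rewrite exprn_egt1 // -lt0n.
case: h => // h in E h0; have {E} : (r ^ m = s ^ m * b ^ h)%N.
  apply/eqP; rewrite -(eqr_nat R) natrM !natrX -exprnP in E *.
  by rewrite expr_div_n in E; rewrite -E mulrC divfK // expf_neq0 // pnatr_eq0 -lt0n.
have [s1 | s1] := eqVneq s 1%N; last first.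
  move=> E; have : coprime (s ^ m) (r ^ m) by rewrite coprimeXl // coprimeXr // coprime_sym.
  rewrite E /coprime gcdnMr.
  by rewrite -[X in _ == X](exp1n m) eqn_exp2r // (negbTE s1).
rewrite s1 exp1n mul1n => E.
(* With s = 1, the cofactor of gcd(b, r) in b divides r ^ m and is coprime to
   r, so it is 1 and b divides r; but r < b. *)
have crb : coprime (b %/ gcdn b r) (r ^ m).
  by rewrite coprimeXr // coprime_sym squarefree_coprime_cofactor //; lia.
have b_cof : (b %/ gcdn b r == 1)%N.
  have cof_dvd : (b %/ gcdn b r %| b ^ h)%N.
    by apply: dvdn_exp => //; apply/dvdn_div/dvdn_gcdl.
  by move: crb; rewrite E => /(coprime_dvdr cof_dvd); rewrite /coprime gcdnn.
have bg : b = gcdn b r by rewrite -[LHS](divnK (dvdn_gcdl b r)) (eqP b_cof) mul1n.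
have /(dvdn_leq r0) : (b %| r)%N by rewrite bg dvdn_gcdr.
lia.
Qed.

(** The bounds on d and d' force h <= 0, so that clearing denominators gives the
    identity of [absorbed_collision] between natural numbers. *)
Lemma meeting_absorbed (R : realType) (b r s d d' j : nat) (h : int) :
  squarefree b -> (1 < b)%N -> coprime r s -> (0 < s)%N -> (s < r)%N ->
  (r < s * b)%N -> (0 < j)%N -> (0 < d < b)%N -> (0 < d' < b)%N ->
  d%:R = d'%:R * (r%:R / s%:R) ^+ j * b%:R ^ h :> R -> absorbed b r s d.
Proof.
move=> sqf b1 crs s0 sr rsb j0 dI d'I E.
have B1 : 1 < b%:R :> R by rewrite ltr1n.
have h0 : h <= 0.
  rewrite leNgt; apply/negP => h0.
  have : b%:R ^ 1 <= b%:R ^ h :> R by rewrite ler_eXz2l.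
  have : 1 * 1 <= d'%:R * (r%:R / s%:R) ^+ j :> R.
    rewrite ler_pM ?ler1n //; first by case/andP: d'I.
    by rewrite exprn_ege1 // ler_pdivlMr ?ltr0n // mul1r ler_nat ltnW.
  have : d%:R < b%:R :> R by rewrite ltr_nat; case/andP: dI.
  rewrite E expr1z; nra.
have hE : h = - `|h|%N%:Z by lia.
apply: (@absorbed_collision b r s d d' j `|h|) => //.
apply/eqP; rewrite -(eqr_nat R) !natrM !natrX E {1}hE -exprnN expr_div_n.
apply/eqP; field.
by rewrite !expf_neq0 // pnatr_eq0; lia.
Qed.

Lemma absorbed_meets (R : realType) (b r s d : nat) :
  (1 < b)%N -> (0 < s)%N -> (s < r)%N -> (0 < d < b)%N -> absorbed b r s d ->
  exists (d' : nat) (h : int),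
    (0 < d' < b)%N /\ d%:R = d'%:R * (r%:R / s%:R) * b%:R ^ h :> R.
Proof.
move=> b1 s0 sr dI /(collision_absorbed _ _ _ _ sr s0 dI)[d' [h [d'I E]]].
exists d', (- h%:Z); split=> //.
have /eqP : (d * s * b ^ h)%:R = (d' * r)%:R :> R by rewrite E.
rewrite !natrM natrX -exprnN => /eqP E'; rewrite mulrA -E'; field.
by rewrite expf_neq0 pnatr_eq0; lia.
Qed.

(** Labels of pairwise distinct breakpoints: a pair (i, d) stands for d lam^(-i),
    and above level 0 the digits whose breakpoint is already present are omitted. *)
Definition fresh (b r s n : nat) : seq (nat * nat) :=
  [seq (0%N, d) | d <- iota 1 (b - 1)] ++
  [seq (i, d) | i <- iota 1 n.-1, d <- [seq d <- iota 1 (b - 1) | ~~ absorbed b r s d]].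

Lemma mem_fresh (b r s n i d : nat) : (0 < b)%N -> (0 < n)%N ->
  ((i, d) \in fresh b r s n) =
  [&& (i < n)%N, (0 < d < b)%N & (i == 0%N) || ~~ absorbed b r s d].
Proof.
move=> b0 n0; rewrite mem_cat.
have dI : (d \in iota 1 (b - 1)) = (0 < d < b)%N by rewrite mem_iota; lia.
have iI : (i \in iota 1 n.-1) = (0 < i < n)%N by rewrite mem_iota; lia.
apply/orP/and3P => [[/mapP[e eI [-> ->]]|/allpairsP[[i' e] [iI' eI [-> ->]]]]|].
- by rewrite n0; split=> //; move: eI; rewrite mem_iota; lia.
- move: iI' eI; rewrite /= mem_filter !mem_iota => iI' /andP[-> eI].
  by rewrite orbT; split=> //; lia.
move=> [ltin dI' /predU1P[-> | nA]].
  by left; apply/mapP; exists d; rewrite ?dI.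
have [->|i0] := posnP i; first by left; apply/mapP; exists d; rewrite ?dI.
right; apply/allpairsP; exists (i, d); split=> //=; first by rewrite iI i0.
by rewrite mem_filter nA dI.
Qed.

Lemma fresh_uniq (b r s n : nat) : uniq (fresh b r s n).
Proof.
rewrite cat_uniq map_inj_uniq ?iota_uniq => [|x y [] //] /=.
rewrite allpairs_uniq ?filter_uniq ?iota_uniq //; last by move=> [x y] [x' y'].
rewrite andbT; apply/hasPn => _ /allpairsP[[i d] [iI _ ->]] /=.
by apply/negP => /mapP[e _ [i0 _]]; move: iI; rewrite i0 mem_iota.
Qed.

Lemma size_fresh (b r s n : nat) :
  size (fresh b r s n) =
  (b - 1 + n.-1 * (b - 1 - count (absorbed b r s) (iota 1 (b - 1))))%N.
Proof.
rewrite size_cat size_map size_allpairs !size_iota size_filter.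
have := count_predC (absorbed b r s) (iota 1 (b - 1)).
by rewrite size_iota => E; rewrite -[X in (_ * (X - _))%N]E addKn.
Qed.

(** * Blocks and breakpoints *)

Lemma card_fset_set_seq (T : choiceType) (W : set T) (t : seq T) :
  uniq t -> (forall w, W w <-> w \in t) -> #|` fset_set W | = size t.
Proof.
move=> t_uniq Wt; have tE := seq_fsetE tt t.
have -> : W = [set` seq_fset tt t]%classic.
  by apply/seteqP; split=> w; [move/Wt | move=> wt; apply/Wt]; rewrite -tE.
by rewrite set_fsetK size_seq_fset undup_id.
Qed.

Section BlockCount.
Local Set Implicit Arguments.
Local Unset Strict Implicit.
Variables (R : realType) (b r s : nat).
Hypotheses (sqf : squarefree b) (b4 : (3 < b)%N) (crs : coprime r s).
Hypotheses (s0 : (0 < s)%N) (sr : (s < r)%N) (rsb : (r < s * b)%N).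
Local Notation lam := (r%:R / s%:R : R).
Local Notation B := (b%:R : R).

Let b1 : (1 < b)%N. Proof. lia. Qed.
Let lam_gt0 : 0 < lam. Proof. by rewrite divr_gt0 ?ltr0n //; lia. Qed.
Let lamX_gt0 (i : nat) : 0 < lam ^+ i. Proof. exact: exprn_gt0. Qed.
Let B_gt0 : 0 < B. Proof. by rewrite ltr0n; lia. Qed.
Let Bz_gt0 (j : int) : 0 < B ^ j. Proof. exact: exprz_gt0. Qed.

(** An absorbed digit is traded for a digit one level lower, until level 0. *)
Lemma fresh_representative (n i d : nat) : (i < n)%N -> (0 < d < b)%N ->
  exists (i' d' : nat) (h : int), (i', d') \in fresh b r s n /\
    d%:R / lam ^+ i = d'%:R / lam ^+ i' * B ^ h.
Proof.
elim: i d => [|i IH] d ltin dI.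
  exists 0%N, d, 0; rewrite mem_fresh ?ltin ?dI ?mulr1 //; lia.
have [/(absorbed_meets R _ _ _ _ b1 s0 sr dI)[d1 [h1 [d1I dE]]]|nA] :=
  boolP (absorbed b r s d); last first.
  exists i.+1, d, 0; rewrite mem_fresh ?ltin ?dI ?nA ?mulr1 //; lia.
have [i' [d' [h [mem E]]]] := IH d1 (ltnW ltin) d1I.
exists i', d', (h + h1); split=> //.
rewrite expfzDr ?gt_eqF // mulrA -E dE exprS invfM.
field; rewrite gt_eqF //=; apply/andP; split; last by rewrite pnatr_eq0; lia.
by rewrite pnatr_eq0; lia.
Qed.

(** Points at levels i < i' that agree modulo powers of b would make d' absorbed; at
    a single level, d and d' agree modulo powers of b and are leading digits of
    themselves, so d = d'. *)
Lemma fresh_inj (i i' d d' : nat) (n : nat) (h : int) : (0 < n)%N ->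
  (i, d) \in fresh b r s n -> (i', d') \in fresh b r s n ->
  d%:R / lam ^+ i = d'%:R / lam ^+ i' * B ^ h -> (i, d) = (i', d').
Proof.
wlog: i i' d d' h / (i <= i')%N => [hw|ii' n0].
  have [|/ltnW] := leqP i i'; first exact: hw.
  move=> ii n0 m m' E; symmetry; apply: (hw _ _ _ _ (- h)) => //.
  by rewrite E -mulrA -expfzDr ?gt_eqF // subrr mulr1.
rewrite !mem_fresh //; try lia.
move=> /and3P[ltin dI _] /and3P[ltin' dI' nA] E.
have E' : d'%:R = d%:R * lam ^+ (i' - i) * B ^ (- h) :> R.
  have BB : B ^ h * B ^ (- h) = 1 by rewrite -expfzDr ?gt_eqF // subrr.
  have solve (x y L M u v : R) : L != 0 -> M != 0 -> u * v = 1 ->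
      x / L = y / (L * M) * u -> y = x * M * v.
    move=> L0 M0 uv xE; have -> : x = y / M * u.
      by rewrite -[x](divfK L0) xE; field; rewrite L0 M0.
    by rewrite -[LHS]mulr1 -uv; field.
  apply: (solve _ _ (lam ^+ i) _ (B ^ h)) => //; try by rewrite gt_eqF.
  by rewrite -exprD subnKC.
case: (posnP (i' - i)) => [ii0|ii0].
  have ie : i = i' by lia.
  move: E'; rewrite ii0 expr0 mulr1 => E'.
  have : leading_digit b (d'%:R : R) = leading_digit b (d%:R : R).
    by rewrite E' leading_digit_scale // ltr0n; case/andP: dI.
  have D e : (0 < e < b)%N -> leading_digit b (e%:R : R) = e.
    by move=> eI; apply: (leading_digit_eq b1 eI (j := 0)); rewrite !mulr1 lexx ltr_nat ltnSn.
  by rewrite !D // => ->; rewrite ie.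
case/orP: nA => [/eqP i'0|/negP[]]; first by lia.
exact: meeting_absorbed E'.
Qed.

(** The codes of the fresh breakpoints are exactly the codes met by the orbit:
    density gives one inclusion, the breakpoint to the left of a point the other. *)
Lemma card_codes (n : nat) : (0 < n)%N ->
  #|` fset_set [set w : n.-tuple nat | exists m : nat,
        (1 <= m)%N /\ w = code b lam n (lam ^+ m)] |
  = size (fresh b r s n).
Proof.
move=> n0; pose point (p : nat * nat) : R := p.2%:R / lam ^+ p.1.
have point_gt0 p : p \in fresh b r s n -> 0 < point p.
  case: p => i d; rewrite mem_fresh //; last by lia.
  by move=> /and3P[_ /andP[d0 _] _]; rewrite divr_gt0 // ltr0n.
have point_bp p : p \in fresh b r s n -> breakpoint b lam n (point p).
  case: p => i d; rewrite mem_fresh //; last by lia.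
  move=> /and3P[ltin dI _]; exists i, d, 0; split=> //.
  by rewrite mulr1 mulrC divfK // gt_eqF.
have code_fresh_inj : {in fresh b r s n &, injective (code b lam n \o point)}.
  move=> p p' pF pF' /= E.
  have [h] := code_inj b1 lam_gt0 b4 n0 (point_gt0 _ pF) (point_gt0 _ pF')
    (point_bp _ pF) (point_bp _ pF') E.
  by case: p p' pF pF' {E} => [i d] [i' d'] pF pF' E; exact: fresh_inj n0 pF pF' E.
rewrite -(size_map (code b lam n \o point)); apply: card_fset_set_seq.
  by rewrite map_inj_in_uniq // fresh_uniq.
move=> w; split.
  move=> [m [m0 ->]]; have xm := lamX_gt0 m.
  have [i [d [ltin dI <-]]] := code_breakpoint b1 lam_gt0 n0 xm.
  have [i' [d' [h [F E]]]] := fresh_representative ltin dI.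
  apply/mapP; exists (i', d') => //=; rewrite E code_scale //.
  exact: (point_gt0 (i', d')).
move=> /mapP[p pF ->]; have p0 := point_gt0 p pF.
have [y py Ey] := code_right_constant b1 lam_gt0 n p0.
have [|m [h [m0 /andP[pm my]]]] := powers_dense R B lam _ lam_gt0
  (ratio_powers_neq R b r s sqf b1 crs s0 sr rsb) _ _ p0 py.
  by rewrite ltr1n.
exists m; split=> //=.
by rewrite -[RHS](code_scale b1 lam_gt0 n h) ?lamX_gt0 // Ey // (ltW pm) my.
Qed.

End BlockCount.

Theorem theorem2p2 (R : realType) (a : R) (b : nat) (hab : admissible a b)
    (k : int) (r s : nat)
    (ha : a = r%:R / s%:R * b%:R ^ k)
    (hrs : coprime r s)
    (hr1 : 1 < r%:R / s%:R :> R)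
    (hrb : r%:R / s%:R < b%:R :> R) :
  (forall n : nat, (1 <= n)%N ->
     (complexity a b n)%:Z = slope b r s * n%:Z + intercept b r s) /\
  intercept b r s = ((b - 1) %/ r)%N%:Z + ((gcdn b r - 1) %/ s)%N%:Z.
Proof.
case: hab => sqf b5 a0 _ _.
split; last by rewrite /intercept /slope; lia.
have s0 : (0 < s)%N.
  by rewrite lt0n; apply/eqP => s0; move: hr1; rewrite s0 invr0 mulr0 ltr10.
have sr : (s < r)%N by move: hr1; rewrite ltr_pdivlMr ?ltr0n // mul1r ltr_nat.
have rsb : (r < s * b)%N.
  by move: hrb; rewrite ltr_pdivrMr ?ltr0n // -natrM ltr_nat mulnC.
have b1 : (1 < b)%N by lia.
move=> n n0; rewrite /complexity.
have blockE m : block (leading_digit_seq a b) m n =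
    code b (r%:R / s%:R : R) n ((r%:R / s%:R) ^+ m).
  apply: eq_from_tnth => i; rewrite !tnth_mktuple /leading_digit_seq ha.
  rewrite exprMn [(b%:R ^ k) ^+ _]exprnP exprz_exp.
  rewrite leading_digit_scale //; last by rewrite exprn_gt0 //; lra.
  by rewrite addnC exprD.
rewrite [X in fset_set X](_ : _ = [set w | exists m : nat,
  (1 <= m)%N /\ w = code b (r%:R / s%:R : R) n ((r%:R / s%:R) ^+ m)]%classic).
  rewrite card_codes //; last by lia.
  have := count_size (absorbed b r s) (iota 1 (b - 1)).
  rewrite size_fresh size_iota count_absorbed //; try lia.
  rewrite /intercept /slope.
  set u := (_ %/ r)%N; set v := (_ %/ s)%N; clearbody u v => uv.
  nia.
by apply/seteqP; split=> w [m [m0 wE]]; exists m; rewrite wE blockE.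
Qed.
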